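(* Suppose $|\mathbb V|=n\ge 2$ and let $\mathcal S=\{R\}$ with $ar(R)=iar(R)=2$. Then composition is primitive in LIF, i.e., there is a LIF expression over $\mathcal S$ that is not equivalent to any LIFnc expression. Specifically, for any LIF expression $\alpha_{2n}$ over $\mathcal S$ such that for every interpretation $D$ $$[\![\alpha_{2n}]\!]_D=\{(\nu_1,\nu_2)\mid \nu_1(\mathbb V)\cup\nu_2(\mathbb V)\text{ is a }2n\text{-clique in }D(R)\},$$ no LIFnc expression is equivalent to the LIF expression $\alpha_{\exists 3n}:=(\alpha_{2n};\alpha_{2n})\cap\alpha_{2n}$.
   Context: **Basic setting.** A vocabulary $\mathcal S$ is a nonempty set of module names, each module name $M$ having an arity $ar(M)$ and an input arity $iar(M)\le ar(M)$. Fix a countably infinite set $\mathbf{dom}$. An interpretation $D$ of $\mathcal S$ assigns to each module name $M$ an $ar(M)$-ary relation $D(M)$ over $\mathbf{dom}$. $\mathbb V$ is a fixed set of variables. A valuation is a function $\mathbb V\to\mathbf{dom}$; $\mathcal V$ is the set of all valuations. Valuations agree outside $Y\subseteq\mathbb V$ if they have equal values on $\mathbb V- Y$. A BRV is a subset of $\mathcal V\times\mathcal V$. **Operations on BRVs** $A,B$ ($Z$ a finite set of variables; $x,y$ variables): union, intersection, set difference $A-B$; composition $A;B=\{(\nu_1,\nu_2)\mid\exists\nu_3:(\nu_1,\nu_3)\in A,(\nu_3,\nu_2)\in B\}$; converse $A^{-1}=\{(\nu_1,\nu_2)\mid(\nu_2,\nu_1)\in A\}$; left cylindrification $\mathrm{cyl}^l_Z(A)=\{(\nu_1,\nu_2)\mid\exists\nu_1':(\nu_1',\nu_2)\in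 A,\ \nu_1'\text{ and }\nu_1\text{ agree outside }Z\}$; right cylindrification $\mathrm{cyl}^r_Z(A)=\{(\nu_1,\nu_2)\mid\exists\nu_2':(\nu_1,\nu_2')\in A,\ \nu_2'\text{ and }\nu_2\text{ agree outside }Z\}$; selections $\sigma^l_{x=y}(A)=\{(\nu_1,\nu_2)\in A\mid\nu_1(x)=\nu_1(y)\}$, $\sigma^r_{x=y}(A)=\{(\nu_1,\nu_2)\in A\mid\nu_2(x)=\nu_2(y)\}$, $\sigma^{lr}_{x=y}(A)=\{(\nu_1,\nu_2)\in A\mid\nu_1(x)=\nu_2(y)\}$. **LIF expressions** over $\mathcal S$ are generated by $\alpha::=\mathit{id}\mid M(\bar x;\bar y)\mid\alpha\cup\alpha\mid\alpha\cap\alpha\mid\alpha-\alpha\mid\alpha;\alpha\mid\alpha^{-1}\mid\mathrm{cyl}^l_Z(\alpha)\mid\mathrm{cyl}^r_Z(\alpha)\mid\sigma^{lr}_{x=y}(\alpha)\mid\sigma^l_{x=y}(\alpha)\mid\sigma^r_{x=y}(\alpha)$, where in an atomic module expression $M(\bar x;\bar y)$ the tuples of variables $\bar x,\bar y$ have lengths $iar(M)$ and $ar(M)-iar(M)$. LIFnc is the fragment of LIF without the operator $;$. Semantics: $[\![\mathit{id}]\!]_D=\{(\nu,\nu)\mid\nu\in\mathcal V\}$; $[\![M(\bar x;\bar y)]\!]_D=\{(\nu_1,\nu_2)\mid\nu_1(\bar x)\cdot\nu_2(\bar y)\in D(M)\text{ and }\nu_1,\nu_2\text{ agree outside }\bar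 y\}$ ($\cdot$ is concatenation of tuples); the other operators are interpreted by the corresponding BRV operations. Two LIF expressions $\alpha,\beta$ are equivalent if $[\![\alpha]\!]_D=[\![\beta]\!]_D$ for every interpretation $D$. **Cliques.** A set $L$ of exactly $k$ data elements is a $k$-clique in a binary relation $R$ if $(a,b)\in R$ for any two distinct $a,b\in L$. For a valuation $\nu$, $\nu(\mathbb V)$ is its image. *)

(* Defs.v *)
From mathcomp Require Import all_boot finmap.
From mathcomp Require Import boolp classical_sets functions cardinality.

Set Implicit Arguments.
Unset Strict Implicit.
Unset Printing Implicit Defensive.

Local Open Scope classical_set_scope.
Local Open Scope card_scope.

Record vocabulary := Vocabulary {
  module_name :> Type;
  ar : module_name -> nat;
  iar : module_name -> nat;
  iar_le_ar : forall M, iar M <= ar M;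
  vocabulary_nonempty : inhabited module_name }.

Definition interpretation (S : vocabulary) (dom : Type) : Type :=
  forall M : S, set ((ar M).-tuple dom).

Section BRV.
Variables (V : choiceType) (dom : Type).

Definition valuation : Type := V -> dom.
Definition BRV : Type := set (valuation * valuation).

Definition agree_outside (Y : set V) (nu1 nu2 : valuation) : Prop :=
  forall v, ~ Y v -> nu1 v = nu2 v.

(* Union, intersection, difference, composition [A \; B] and converse [A^-1]
   of BRVs are those of classical_sets; composition is diagrammatic. *)

Definition cyl_l (Z : {fset V}) (A : BRV) : BRV :=
  [set p | exists nu1', A (nu1', p.2) /\ agree_outside [set` Z] nu1' p.1].

Definition cyl_r (Z : {fset V}) (A : BRV) : BRV :=
  [set p | exists nu2', A (p.1, nu2') /\ agree_outside [set` Z] nu2' p.2].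

Definition sel_l (x y : V) (A : BRV) : BRV := [set p | A p /\ p.1 x = p.1 y].
Definition sel_r (x y : V) (A : BRV) : BRV := [set p | A p /\ p.2 x = p.2 y].
Definition sel_lr (x y : V) (A : BRV) : BRV := [set p | A p /\ p.1 x = p.2 y].

End BRV.

Section LIF.
Variables (S : vocabulary) (V : choiceType).

Inductive LIF : Type :=
  | Id
  | Module (M : S) (x : (iar M).-tuple V) (y : (ar M - iar M).-tuple V)
  | Union (a b : LIF)
  | Inter (a b : LIF)
  | Diff (a b : LIF)
  | Comp (a b : LIF)
  | Conv (a : LIF)
  | CylL (Z : {fset V}) (a : LIF)
  | CylR (Z : {fset V}) (a : LIF)
  | SelLR (x y : V) (a : LIF)
  | SelL (x y : V) (a : LIF)
  | SelR (x y : V) (a : LIF).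

Fixpoint is_LIFnc (a : LIF) : bool :=
  match a with
  | Id | Module _ _ _ => true
  | Union a b | Inter a b | Diff a b => is_LIFnc a && is_LIFnc b
  | Comp _ _ => false
  | Conv a | CylL _ a | CylR _ a | SelLR _ _ a | SelL _ _ a | SelR _ _ a =>
      is_LIFnc a
  end.

Variable dom : Type.

(* The concatenated tuple has length [iar M + (ar M - iar M)], whence the cast
   to length [ar M]. *)
Definition module_sem (D : interpretation S dom) (M : S)
    (x : (iar M).-tuple V) (y : (ar M - iar M).-tuple V) : BRV V dom :=
  [set p | D M (tcast (subnKC (iar_le_ar M))
                  (cat_tuple (map_tuple p.1 x) (map_tuple p.2 y)))
           /\ agree_outside [set` y] p.1 p.2].

Fixpoint sem (D : interpretation S dom) (a : LIF) : BRV V dom :=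
  match a with
  | Id => [set p | p.1 = p.2]
  | Module M x y => module_sem D x y
  | Union a b => sem D a `|` sem D b
  | Inter a b => sem D a `&` sem D b
  | Diff a b => sem D a `\` sem D b
  | Comp a b => (sem D a \; sem D b)%relation
  | Conv a => ((sem D a)^-1)%relation
  | CylL Z a => cyl_l Z (sem D a)
  | CylR Z a => cyl_r Z (sem D a)
  | SelLR x y a => sel_lr x y (sem D a)
  | SelL x y a => sel_l x y (sem D a)
  | SelR x y a => sel_r x y (sem D a)
  end.

Definition LIF_equiv (a b : LIF) : Prop :=
  forall D : interpretation S dom, sem D a = sem D b.

End LIF.

Arguments Id {S V}.

Definition composition_primitive (S : vocabulary) (V : choiceType)
    (dom : Type) : Prop :=
  exists a : LIF S V, forall b : LIF S V, is_LIFnc b -> ~ LIF_equiv dom a b.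

Definition is_clique (T : Type) (k : nat) (E : T -> T -> Prop) (L : set T) :
    Prop :=
  L #= `I_k /\ forall a b, L a -> L b -> a <> b -> E a b.

Definition vocR : vocabulary :=
  @Vocabulary unit (fun _ => 2) (fun _ => 2) (fun _ => leqnn 2) (inhabits tt).

Definition relR (dom : Type) (D : interpretation vocR dom) (a b : dom) : Prop :=
  D tt [tuple a; b].

Definition defines_clique (V : choiceType) (dom : Type) (k : nat)
    (a : LIF vocR V) : Prop :=
  forall D : interpretation vocR dom,
    sem D a = [set p | is_clique k (relR D) (range p.1 `|` range p.2)].

Definition alpha_exists3n (V : choiceType) (a2n : LIF vocR V) : LIF vocR V :=
  Inter (Comp a2n a2n) a2n.

(* Main.v *)
(** LIFnc expressions only ever talk about the [2n] values held by a pair of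
    valuations, so they cannot separate pairs related by a winning position of
    the [2n]-pebble game. Let [D_m] interpret [R] as the complete multipartite
    graph with [m] infinite parts. As long as both part counts are at least
    [2n], the positions with the same equality and same-part patterns are
    winning: when one pebble is moved, the other [2n - 1] leave a part
    untouched. A [2n]-clique is contained in a [3n]-clique of [D_3n], but
    [D_2n] has no clique with more than [2n] elements. *)

Require Import Defs.
From mathcomp Require Import all_boot finmap.
From mathcomp Require Import boolp classical_sets functions cardinality.

Set Implicit Arguments.
Unset Strict Implicit.
Unset Printing Implicit Defensive.

Local Open Scope classical_set_scope.
Local Open Scope card_scope.

(** Pigeonhole: without [i] fewer than [m] indices remain, too few to take every value below [m]. *)
Lemma missed_value (I : finType) (phi : I -> nat) (i : I) (m : nat) :
  #|I| <= m -> exists2 r, r < m & forall j, j != i -> phi j <> r.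
Proof.
move=> Im; apply: contrapT => nr.
have : size (iota 0 m) <= size [seq phi j | j <- enum (predC1 i)].
  apply: uniq_leq_size (iota_uniq _ _) _ => r; rewrite mem_iota => /andP[_ rm].
  apply: contrapT => phi_r; apply: nr; exists r => // j ji phij; apply: phi_r.
  by apply/mapP; exists j; rewrite ?mem_enum.
rewrite size_iota size_map -cardE cardC1 leqNgt => /negP; apply.
by apply: leq_trans Im; rewrite prednK //; apply/card_gt0P; exists i.
Qed.

(** * Winning positions of the pebble game *)

Section Pebbles.
Variables (I : finType) (dom color : Type).
Implicit Types (c : dom -> color) (f g : I -> dom).

(** Pebbles are indexed by [I] and colours name parts. Only coincidences of colours are compared, as
    the two sides may have different numbers of parts. *)
Definition same_type c c' f g : Prop := forall i j,
  (f i = f j <-> g i = g j) /\ (c (f i) = c (f j) <-> c' (g i) = c' (g j)).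

Definition rich c : Prop :=
  (forall g i, exists b, forall j, j != i -> c b <> c (g j)) /\
  (forall g a, exists b, c b = c a /\ forall j, b <> g j).

Lemma same_type_sym c c' f g : same_type c c' f g -> same_type c' c g f.
Proof. by move=> fg i j; have [[? ?] [? ?]] := fg i j. Qed.

(** The new value equals that of another pebble, or is new in the part of another pebble, or lies in
    a part free of the others; the answer [b] is of the same kind. *)
Lemma same_type_move c c' f g i a : rich c' -> same_type c c' f g ->
  exists b, same_type c c' [eta f with i |-> a] [eta g with i |-> b].
Proof.
move=> [fresh_part fresh_elt] fg.
suff [b bP] : exists b, forall j, j != i ->
    (f j = a <-> g j = b) /\ (c (f j) = c a <-> c' (g j) = c' b).
  exists b => j k /=.
  have [_|ji] := eqVneq j i; have [_|ki] := eqVneq k i.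
  - by split.
  - have [[? ?] [? ?]] := bP k ki.
    by split; split => /esym ?; apply/esym; auto.
  - exact: bP.
  - exact: fg.
have [[j [ji fja]]|nelt] := pselect (exists j, j != i /\ f j = a).
  by exists (g j) => k _; rewrite -fja; exact: fg.
have [[j [ji fja]]|npart] := pselect (exists j, j != i /\ c (f j) = c a).
  have [b [cb bg]] := fresh_elt g (g j).
  exists b => k ki; rewrite cb -fja; split; last by have [] := fg k j.
  by split=> [fka|gkb]; [case: nelt; exists k | case: (bg k)].
have [b bP] := fresh_part g i.
exists b => k ki; split; split => e.
- by case: nelt; exists k.
- by case: (bP k ki); rewrite e.
- by case: npart; exists k.
- by case: (bP k ki).
Qed.

Lemma same_type_moves c c' (s : seq I) f f' g : rich c' ->
    same_type c c' f g -> (forall j, j \notin s -> f' j = f j) ->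
  exists2 g', same_type c c' f' g' & forall j, j \notin s -> g' j = g j.
Proof.
move=> rc' fg; elim: s f' => [|i s IHs] f' f'P.
  exists g => // j k; rewrite !f'P //; exact: fg.
(* Pebble [i] is put back to its old value, so that the induction hypothesis moves only pebbles of
   the shorter list. *)
have [j js|g'' fg'' g''P] := IHs [eta f' with i |-> f i].
  by rewrite /=; case: eqVneq => [->//|ji]; rewrite f'P // inE negb_or ji.
have [b fgb] := same_type_move i (f' i) rc' fg''.
exists [eta g'' with i |-> b] => [j k|j]; last first.
  by rewrite inE negb_or /= => /andP[/negPf-> /g''P].
have f'E l : [eta [eta f' with i |-> f i] with i |-> f' i] l = f' l.
  by rewrite /=; case: eqVneq => [->|].
by have := fgb j k; rewrite !f'E.
Qed.

End Pebbles.

(** * Colourings with infinite parts *)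

Section Multipartite.
Variables (dom : Type) (e : dom -> nat) (d : nat -> dom).
Hypothesis (dK : cancel d e).

Definition part (m : nat) (a : dom) : nat := e a %% m.

Lemma rich_part (I : finType) (m : nat) :
  #|I| <= m -> 0 < m -> @rich I dom nat (part m).
Proof.
move=> Im m0; split=> [g i|g a].
  have [r rm rP] := missed_value (part m \o g) i Im.
  by exists (d r) => j /rP /nesym; rewrite {2}/part dK modn_small.
(* Adding a multiple of [m] keeps the residue, and this one exceeds the codes of all pebbles. *)
exists (d (e a + m * (\max_j e (g j)).+1)); rewrite /part dK; split=> [|j gj].
  by rewrite addnC mulnC modnMDl.
have := leq_bigmax (F := fun j => e (g j)) j.
rewrite -gj dK leqNgt => /negP; apply.
by apply: ltn_addl; exact: leq_pmull.
Qed.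

End Multipartite.

(** * Invariance of LIFnc expressions *)

Section PebblesLIF.
Variables (V : finType) (dom : Type).
Implicit Types (p q : valuation V dom * valuation V dom) (c : dom -> nat).

Definition joint p (i : V + V) : dom :=
  match i with inl x => p.1 x | inr x => p.2 x end.

Lemma range_joint p : range p.1 `|` range p.2 = range (joint p).
Proof.
apply/seteqP; split=> a.
  by case=> -[x _ <-]; [exists (inl x) | exists (inr x)].
by case=> -[x|x] _ <-; [left | right]; exists x.
Qed.

(** The output tuple is empty because [ar] and [iar] agree, so the two valuations must coincide
    everywhere. *)
Lemma sem_moduleE (D : interpretation vocR dom) (M : vocR)
    (x : (iar M).-tuple V) (y : (ar M - iar M).-tuple V) p :
  sem D (Module x y) p <->
  relR D (p.1 (tnth x ord0)) (p.1 (tnth x ord_max)) /\ p.1 = p.2.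
Proof.
case: M x y => /= x y.
have y0 : [set` y] = set0.
  by rewrite (tuple0 (y : 0.-tuple V)); apply/seteqP; split.
rewrite /module_sem /agree_outside y0 /relR /=; set t := tcast _ _.
have -> : t = [tuple p.1 (tnth x ord0); p.1 (tnth x ord_max)].
  rewrite {}/t; apply: val_inj; apply: etrans (val_tcast _ _) _.
  rewrite /= (tuple0 (y : 0.-tuple V)) cats0.
  case: x => -[|a [|b []]] //=.
split=> -[? h]; split=> //; first by apply/funext => v; exact: h.
by move=> v _; rewrite h.
Qed.

Definition multipartite c : interpretation vocR dom :=
  fun _ => [set t | c (tnth t ord0) <> c (tnth t ord_max)].

Lemma relR_multipartite c a b : relR (multipartite c) a b = (c a <> c b).
Proof. by []. Qed.

Lemma same_type_conv c c' p q : same_type c c' (joint p) (joint q) ->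
  same_type c c' (joint (p.2, p.1)) (joint (q.2, q.1)).
Proof.
by move=> pq i j; have := pq (match i with inl x => inr x | inr x => inl x end)
  (match j with inl x => inr x | inr x => inl x end); case: i; case: j.
Qed.

(** Changing the left valuation on [Z] amounts to moving the pebbles [inl z] for [z] in [Z]; the
    right ones stay put. *)
Lemma same_type_cyl_l c c' (Z : {fset V}) p q nu : rich (V + V)%type c' ->
    same_type c c' (joint p) (joint q) -> agree_outside [set` Z] nu p.1 ->
  exists2 mu, same_type c c' (joint (nu, p.2)) (joint (mu, q.2))
            & agree_outside [set` Z] mu q.1.
Proof.
move=> rc' pq nuP.
have [|h hP hq] := @same_type_moves _ _ _ c c' [seq inl z | z <- Z] _
    (joint (nu, p.2)) _ rc' pq.
  case=> //= x; rewrite mem_map => [/negP|? ? [] //]; exact: nuP.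
exists (h \o inl) => [i j|x /negP xZ]; last first.
  by rewrite /= hq // mem_map => [|? ? []].
have hE k : joint (h \o inl, q.2) k = h k.
  by case: k => //= x; rewrite hq //; apply/mapP => -[].
by rewrite !hE; exact: hP.
Qed.

(** Induction on [b] with both colourings universally quantified, since the subtracted expression of
    a difference is transferred backwards. *)
Lemma same_type_sem c c' (b : LIF vocR V) p q :
    rich (V + V)%type c -> rich (V + V)%type c' -> is_LIFnc b ->
    same_type c c' (joint p) (joint q) ->
  sem (multipartite c) b p -> sem (multipartite c') b q.
Proof.
move=> rc rc'; elim: b c c' rc rc' p q => [|M x y|b IHb b' IHb'|b IHb b' IHb'
  |b IHb b' IHb'|//|b IHb|Z b IHb|Z b IHb|x y b IHb|x y b IHb|x y b IHb]
  c c' rc rc' p q nc pq.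
- move=> /= p12; apply/funext => v.
  by have [[+ _] _] := pq (inl v) (inr v); apply; rewrite /= p12.
- rewrite !sem_moduleE !relR_multipartite => -[cx p12]; split.
    move=> cx'; apply: cx.
    by have [_ [_]] := pq (inl (tnth x ord0)) (inl (tnth x ord_max)); apply.
  apply/funext => v.
  by have [[+ _] _] := pq (inl v) (inr v); apply; rewrite /= p12.
- case/andP: nc => nb nb' /= -[] h; [left|right].
    exact: IHb pq h.
  exact: IHb' pq h.
- case/andP: nc => nb nb' /= -[h h']; split.
    exact: IHb pq h.
  exact: IHb' pq h'.
- case/andP: nc => nb nb' /= -[h h']; split; first exact: IHb pq h.
  by move=> h''; apply: h'; apply: IHb' (same_type_sym pq) h''.
- exact: IHb (same_type_conv pq).
- case=> nu [nub nuZ].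
  have [mu pq' muZ] := same_type_cyl_l rc' pq nuZ.
  by exists mu; split=> //; apply: IHb pq' nub.
- case=> nu [nub nuZ].
  (* Swapping the two valuations reduces right cylindrification to the left one. *)
  have [mu pq' muZ] := same_type_cyl_l rc' (same_type_conv pq) nuZ.
  by exists mu; split=> //; apply: IHb (same_type_conv pq') nub.
- case=> h e; split; first exact: IHb pq h.
  by have [[+ _] _] := pq (inl x) (inr y); apply.
- case=> h e; split; first exact: IHb pq h.
  by have [[+ _] _] := pq (inl x) (inl y); apply.
- case=> h e; split; first exact: IHb pq h.
  by have [[+ _] _] := pq (inr x) (inr y); apply.
Qed.

End PebblesLIF.

(** A range indexed by [I] has exactly [#|I|] elements only if [h] is injective. *)
Lemma is_clique_range (I : finType) (T : Type) (E : T -> T -> Prop)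
    (h : I -> T) :
  is_clique #|I| E (range h) <->
  forall i j, i != j -> h i <> h j /\ E (h i) (h j).
Proof.
split=> [[/card_set_bijP[phi [phi_fun phi_inj phi_surj]] clq] i j ij|hP].
  suff hij : h i <> h j by split=> //; apply: clq => //; eexists.
  move=> hij.
  (* As [h i = h j], index [i] is redundant: a value missed by the other indices is missed by [phi]
     altogether. *)
  have [r rI rP] := missed_value (phi \o h) i (leqnn _).
  have [_ [k _ <-] phi_r] := phi_surj r rI.
  have [ki|/rP//] := eqVneq k i.
  by case: (rP j); rewrite ?[j == i]eq_sym //= -hij -ki.
have h_inj : injective h.
  by move=> i j hij; apply: contrapT => /eqP /hP[].
split.
  apply: card_eq_trans (inj_card_eq (in2W h_inj)) _.
  apply/pcard_eqP/bijPex; exists (fun i => val (enum_rank i)).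
  split=> [i _|i j _ _ /val_inj/enum_rank_inj//|r /= rI]; first exact: ltn_ord.
  by exists (enum_val (Ordinal rI)); rewrite ?enum_valK.
move=> _ _ [i _ <-] [j _ <-] hij; apply hP; apply/eqP => ij.
by rewrite ij in hij.
Qed.

Lemma sem_defines_clique (V : finType) (dom : Type) (a : LIF vocR V)
    (D : interpretation vocR dom) (p : valuation V dom * valuation V dom) :
  defines_clique dom (2 * #|V|) a ->
  sem D a p <-> forall i j : V + V, i != j ->
    joint p i <> joint p j /\ relR D (joint p i) (joint p j).
Proof.
move=> aP; rewrite (aP D) /= range_joint mul2n -addnn -card_sum.
exact: is_clique_range.
Qed.

(** * A LIF expression for the 2n-cliques *)

Section CliqueExpression.
Variables (V : finType) (dom : Type).
Implicit Types (D : interpretation vocR dom) (x y : V) (i j : V + V).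

Definition all_vars : {fset V} := [fset x in enum V]%fset.

Lemma agree_outside_all_vars (nu mu : valuation V dom) :
  agree_outside [set` all_vars] nu mu.
Proof. by move=> v; case; rewrite /= in_fset /= mem_enum. Qed.

Definition all_pairs : LIF vocR V := CylL all_vars Id.

Lemma sem_all_pairs D p : sem D all_pairs p.
Proof. by exists p.2; split=> //; exact: agree_outside_all_vars. Qed.

Definition joint_eq i j : LIF vocR V :=
  match i, j with
  | inl x, inl y => SelL x y all_pairs
  | inr x, inr y => SelR x y all_pairs
  | inl x, inr y | inr y, inl x => SelLR x y all_pairs
  end.

Lemma sem_joint_eq D i j p : sem D (joint_eq i j) p <-> joint p i = joint p j.
Proof.
have pT := sem_all_pairs D p.
by case: i j => [x|x] [y|y]; split=> [[]|]; rewrite //; split.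
Qed.

(** A spare variable; the default [x] is reached only when [V] has no second variable. *)
Definition other x : V := odflt x [pick z | z != x].

Lemma other_neq x : 1 < #|V| -> other x != x.
Proof.
rewrite /other => V1; case: pickP => [//|/= eqx].
move: V1; rewrite (cardD1 x) inE ltnS lt0n => /eqP; case.
by apply: eq_card0 => z; rewrite !inE eqx.
Qed.

(** The module forces equal valuations; the cylindrification frees the right one. *)
Definition edge_ll x y : LIF vocR V :=
  CylR all_vars (@Module vocR V tt [tuple x; y] [tuple]).

Lemma sem_edge_ll D x y p : sem D (edge_ll x y) p <-> relR D (p.1 x) (p.1 y).
Proof.
split=> [[nu [/sem_moduleE[/= h _] _]]|h]; first exact: h.
exists p.1; split; last exact: agree_outside_all_vars.
by apply/sem_moduleE.
Qed.

(* A second left variable is made to carry the right value of [y], then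
   forgotten. *)
Definition edge_lr x y : LIF vocR V :=
  CylL [fset other x]%fset (SelLR (other x) y (edge_ll x (other x))).

Lemma sem_edge_lr D x y p : 1 < #|V| ->
  sem D (edge_lr x y) p <-> relR D (p.1 x) (p.2 y).
Proof.
move=> /(other_neq x) zx; split=> [[nu [[/sem_edge_ll /= h zy] nup]]|h].
  rewrite -nup -?zy // /= inE; apply/negP; rewrite eq_sym //.
exists [eta p.1 with other x |-> p.2 y]; split=> [|v /= /negP]; last first.
  by rewrite inE => /negPf->.
split; last by rewrite /= eqxx.
by apply/sem_edge_ll; rewrite /= eqxx eq_sym (negPf zx).
Qed.

Definition joint_edge i j : LIF vocR V :=
  match i, j with
  | inl x, inl y => edge_ll x y
  | inr x, inr y => Conv (edge_ll x y)
  | inl x, inr y => edge_lr x y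
  | inr x, inl y => Conv (edge_lr x y)
  end.

Lemma sem_joint_edge D i j p : 1 < #|V| ->
  sem D (joint_edge i j) p <-> relR D (joint p i) (joint p j).
Proof.
move=> V1; case: i j => [x|x] [y|y]; [exact: sem_edge_ll|exact: sem_edge_lr| |].
  exact: (sem_edge_lr D x y (p.2, p.1) V1).
exact: (sem_edge_ll D x y (p.2, p.1)).
Qed.

(** A finite conjunction over ordered pairs of distinct positions, with [all_pairs] as the empty
    conjunction. *)
Definition joint_clique : LIF vocR V :=
  foldr (fun ij a => Inter (Diff (joint_edge ij.1 ij.2) (joint_eq ij.1 ij.2)) a)
    all_pairs [seq ij <- enum {: (V + V) * (V + V)} | ij.1 != ij.2].

Lemma joint_clique_defines : 1 < #|V| ->
  defines_clique dom (2 * #|V|) joint_clique.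
Proof.
move=> V1 D; apply/seteqP.
suff pP p : sem D joint_clique p <-> forall i j, i != j ->
    joint p i <> joint p j /\ relR D (joint p i) (joint p j).
  split=> p; rewrite /= range_joint mul2n -addnn -card_sum.
    by move=> /pP h; apply/is_clique_range.
  by move=> /is_clique_range h; apply/pP.
rewrite /joint_clique; set s := filter _ _.
suff sP : sem D joint_clique p <-> forall ij, ij \in s ->
    joint p ij.1 <> joint p ij.2 /\ relR D (joint p ij.1) (joint p ij.2).
  apply: iff_trans sP _; split=> h => [i j ij|ij].
    by apply: (h (i, j)); rewrite mem_filter mem_enum ij.
  by rewrite mem_filter => /andP[/h].
rewrite /joint_clique -/s; elim: s => [|ij s IHs] /=.
  by split=> // _; exact: sem_all_pairs.
split=> [[[/sem_joint_edge h h'] /IHs hs] kl|h].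
  by rewrite inE => /orP[/eqP->|/hs//]; split; [move/sem_joint_eq | exact: h].
have [nij eij] := h ij (mem_head _ _).
split; last by apply/IHs => kl kls; apply: h; rewrite inE kls orbT.
by split; [apply/sem_joint_edge | move/sem_joint_eq].
Qed.

End CliqueExpression.

(** * Inexpressibility of extension to a 3n-clique *)

Section Inexpressibility.
Variables (V : finType) (dom : Type) (e : dom -> nat) (d : nat -> dom).
Hypothesis (dK : cancel d e).

(** With [n = #|V|], block [k] takes the [n] consecutive codes from [k * n] on, so blocks 0, 1 and 2
    meet each part of [D_3n] exactly once. *)
Definition block (k : nat) : valuation V dom :=
  fun v => d (k * #|V| + enum_rank v).

Lemma part_block m k v : k.+1 * #|V| <= m ->
  part e m (block k v) = k * #|V| + enum_rank v.
Proof.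
move=> km; rewrite /part dK modn_small //; apply: leq_trans km.
by rewrite mulSn addnC ltn_add2r.
Qed.

Lemma block_code_inj k l (v w : V) :
  k * #|V| + enum_rank v = l * #|V| + enum_rank w -> k = l /\ v = w.
Proof.
move=> kl; have V0 : 0 < #|V| by apply/card_gt0P; exists v.
have := congr1 (divn^~ #|V|) kl.
rewrite !divnMDl // !divn_small // !addn0 => k_l; split=> //.
by move: kl; rewrite k_l => /addnI/val_inj/enum_rank_inj.
Qed.

Lemma block_clique (a : LIF vocR V) k l : defines_clique dom (2 * #|V|) a ->
    k != l -> k < 3 -> l < 3 ->
  sem (multipartite (part e (3 * #|V|))) a (block k, block l).
Proof.
move=> aP kl k3 l3; apply/(sem_defines_clique _ _ aP) => i j ij.
suff hE : part e (3 * #|V|) (joint (block k, block l) i) <>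
    part e (3 * #|V|) (joint (block k, block l) j).
  by split=> // h; apply: hE; rewrite h.
case: i j ij => [v|v] [w|w] ij;
  rewrite /= !part_block ?leq_mul2r ?k3 ?l3 ?orbT //;
  case/block_code_inj => kl' vw; move: ij kl; rewrite ?kl' ?vw ?eqxx //.
Qed.

(** Blocks 0 and 1 together meet all parts of [D_2n], so any value of [mu] shares its part with a
    value of one of them and is not adjacent to it. *)
Lemma block_not_extendable (a : LIF vocR V) mu :
    defines_clique dom (2 * #|V|) a -> 0 < #|V| ->
    sem (multipartite (part e (2 * #|V|))) a (block 0, mu) ->
    sem (multipartite (part e (2 * #|V|))) a (mu, block 1) ->
  False.
Proof.
move=> aP V0 /(sem_defines_clique _ _ aP) h0 /(sem_defines_clique _ _ aP) h1.
have /card_gt0P[v0 _] := V0.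
set r := part e (2 * #|V|) (mu v0).
have r2 : r < 2 * #|V| by rewrite ltn_mod muln_gt0.
have [rV|Vr] := ltnP r #|V|.
  have [//|_] := h0 (inl (enum_val (Ordinal rV))) (inr v0).
  by rewrite relR_multipartite /= part_block ?enum_valK ?leq_mul2r ?orbT.
have rV : r - #|V| < #|V| by rewrite ltn_subLR // addnn -mul2n.
have [//|_] := h1 (inl v0) (inr (enum_val (Ordinal rV))).
by rewrite relR_multipartite /= part_block // enum_valK /= mul1n subnKC.
Qed.

Lemma exists3n_not_LIFnc (a b : LIF vocR V) : defines_clique dom (2 * #|V|) a ->
  0 < #|V| -> is_LIFnc b -> ~ LIF_equiv dom (alpha_exists3n a) b.
Proof.
move=> aP V0 nb ab.
have richP m : 1 < m -> rich (V + V)%type (part e (m * #|V|)).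
  move=> m1; apply: (rich_part dK); last by rewrite muln_gt0 V0 ltnW.
  by rewrite card_sum addnn -mul2n leq_mul2r m1 orbT.
have : sem (multipartite (part e (3 * #|V|))) b (block 0, block 1).
  rewrite -ab; split; last exact: block_clique.
  (* In [D_3n] block 2 occupies the [n] remaining parts, so it serves as the middle valuation. *)
  by exists (block 2); exact: block_clique.
move/(same_type_sem (richP 3 isT) (richP 2 isT) nb).
move=> /(_ (block 0, block 1)); rewrite -ab; case.
  move=> i j; split=> //.
  (* All codes here are below [2 * n], so each value has the same colour in [D_3n] and [D_2n]. *)
  by case: i j => [v|v] [w|w]; rewrite /= !part_block // leq_mul2r orbT.
by case=> mu h0 h1 _; exact: block_not_extendable h0 h1.
Qed.

End Inexpressibility.

Theorem theorem7p12 (dom : Type) (V : finType) (n : nat)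
    (hdom : [set: dom] #= [set: nat]) (hV : #|V| = n) (hn : (2 <= n)%N) :
  composition_primitive vocR V dom
  /\ forall a2n : LIF vocR V, defines_clique dom (2 * n) a2n ->
     forall b : LIF vocR V, is_LIFnc b ->
       ~ LIF_equiv dom (alpha_exists3n a2n) b.
Proof.
have /card_set_bijP[e [_ _ e_surj]] := hdom.
(* [d] is a section of the surjective coding [e] of the data elements. *)
have /choice[d dK] : forall k, exists a, e a = k.
  by move=> k; have [a _ <-] := e_surj k I; exists a.
rewrite -{n}hV in hn *.
have main a b := @exists3n_not_LIFnc V dom e d dK a b ^~ (ltnW hn).
split; last by move=> a aP b; exact: main.
exists (alpha_exists3n (joint_clique V)) => b; apply: main.
exact: joint_clique_defines.
Qed.
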